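(* Let $G$ be a connected graph and let $U\subseteq V(G)$ be an infinite set of vertices. Then there is a tree-decomposition of $G$ of finite adhesion that displays precisely the set of undominated ends in $\partial U$ (that is, the set of those ends of $G$ that lie in $\partial U$ and are not dominated).
   Context: Ends. A ray is a one-way infinite path. Two rays in a graph $G$ are equivalent if no finite set of vertices separates them; the equivalence classes are the ends of $G$, and $\Omega(G)$ is the set of ends. For a finite $X\subseteq V(G)$ and $\omega\in\Omega(G)$, $C(X,\omega)$ is the unique component of $G-X$ containing a tail of every ray in $\omega$; we say that $\omega$ lives in $C(X,\omega)$. A vertex $v$ dominates a ray $R$ if there is a subdivided infinite star with centre $v$ and all leaves in $R$; it dominates an end $\omega$ if it dominates some (equivalently, every) ray in $\omega$. An end is dominated if some vertex dominates it, and undominated otherwise. For $U\subseteq V(G)$, $\partial U$ is the set of ends $\omega$ such that $C(X,\omega)\cap U\ne\emptyset$ for every finite $X\subseteq V(G)$ (equivalently, the set of ends in the closure of $U$ in the space formed by $G$ together with its ends). Tree-decompositions. A tree-decomposition of $G$ is a pair $\mathcal T=(T,\mathcal V)$ of a tree $T$ and a family $\mathcal V=(V_t)_{t\in T}$ of subsets of $V(G)$ (the parts) such that every vertex of $G$ lies in some $V_t$, every edge of $G$ lies in some $G[V_t]$, and $V_{t_1}\cap V_{t_3}\subseteq V_{t_2}$ whenever $t_2$ lies on the path from $t_1$ to $t_3$ in $T$. For an edge $e=xy$ of $T$ let $T_x\ni x$ and $T_y\ni y$ be the components of $T-e$, $A_x=\bigcup_{t\in T_x}V_t$, $A_y=\bigcup_{t\in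 T_y}V_t$ and $X_e=V_x\cap V_y$. $\mathcal T$ has finite adhesion if all $X_e$ are finite. In that case every end $\omega$ of $G$ orients each edge $e=xy$ of $T$ towards $x$ or $y$ according to whether $\omega$ lives in a component of $G[A_x]-X_e$ or of $G[A_y]-X_e$; this orientation points towards a unique node or a unique end of $T$, and $f_{\mathcal T}:\Omega(G)\to V(T)\cup\Omega(T)$ sends $\omega$ to this node or end. The boundary of $\mathcal T$ is $f_{\mathcal T}^{-1}[\Omega(T)]$. $\mathcal T$ displays a set $\Psi\subseteq\Omega(G)$ if $\Psi$ is the boundary of $\mathcal T$ and $f_{\mathcal T}$ restricts to a bijection $\Psi\to\Omega(T)$. *)

(* Defs.v *)
From mathcomp Require Import all_boot.
From mathcomp Require Import boolp classical_sets functions cardinality.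

Set Implicit Arguments.
Unset Strict Implicit.
Unset Printing Implicit Defensive.

Local Open Scope classical_set_scope.

(* Simple graphs, of arbitrary cardinality. Asking for a choiceType and a
   boolean adjacency relation loses no generality: with the axioms of boolp,
   every type carries a choiceType structure and every relation is boolean. *)
Record graph := Graph {
  vertex :> choiceType;
  adj : rel vertex;
  adj_sym : symmetric adj;
  adj_irrefl : irreflexive adj }.
Arguments adj {g}.

(* x :: p is a path from x to y. *)
Definition is_path (G : graph) (x y : G) (p : seq G) : Prop :=
  [/\ path adj x p, uniq (x :: p) & last x p = y].

(* x and y are joined by a path in the induced subgraph G[A]. *)
Definition joined (G : graph) (A : set G) (x y : G) : Prop :=
  exists2 p, is_path x y p & forall z, z \in x :: p -> A z.

(* C is the vertex set of a component of G[A]; as G - X = G[~` X], the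
   components of G - X are those C with component (~` X) C. *)
Definition component (G : graph) (A C : set G) : Prop :=
  exists2 x, A x & C = [set y | joined A x y].

Definition connected_graph (G : graph) : Prop :=
  inhabited G /\ forall x y : G, joined setT x y.

Definition acyclic (G : graph) : Prop :=
  forall c : seq G, 2 < size c -> ~~ ucycleb adj c.

Definition is_tree (T : graph) : Prop := connected_graph T /\ acyclic T.

Record ray (G : graph) := Ray {
  ray_fun :> nat -> G;
  ray_inj : injective ray_fun;
  ray_adj : forall n, adj (ray_fun n) (ray_fun n.+1) }.

Definition separates (G : graph) (X A B : set G) : Prop :=
  forall a b, A a -> B b -> ~ joined (~` X) a b.

Definition ray_equiv (G : graph) (R S : ray G) : Prop :=
  forall X : set G, finite_set X -> ~ separates X (range R) (range S).

Definition is_end (G : graph) (w : set (ray G)) : Prop :=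
  exists R, w = [set S | ray_equiv R S].

Definition graph_end (G : graph) : Type := {w : set (ray G) | is_end w}.

Definition in_end (G : graph) (R : ray G) (w : graph_end G) : Prop := sval w R.

Definition tail_in (G : graph) (R : ray G) (C : set G) : Prop :=
  exists n, forall m, n <= m -> C (R m).

(* C(X, w). For finite X exactly one C qualifies, and the union is that C. *)
Definition end_component (G : graph) (X : set G) (w : graph_end G) : set G :=
  \bigcup_(C in [set C | component (~` X) C /\
                         forall R, in_end R w -> tail_in R C]) C.

(* The seqs v :: P i are the paths replacing the edges of a star with centre v;
   countably many suffice, since the leaves lie on a ray. *)
Definition dominates_ray (G : graph) (v : G) (R : ray G) : Prop :=
  exists P : nat -> seq G,
    [/\ forall i, P i <> [::],
        forall i, is_path v (last v (P i)) (P i),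
        forall i, range R (last v (P i))
      & forall i j z, i <> j -> z \in P i -> z \notin P j].

Definition dominates_end (G : graph) (v : G) (w : graph_end G) : Prop :=
  exists2 R, in_end R w & dominates_ray v R.

Definition dominated (G : graph) (w : graph_end G) : Prop :=
  exists v, dominates_end v w.

(* The set of ends written \partial U. *)
Definition end_boundary (G : graph) (U : set G) : set (graph_end G) :=
  [set w | forall X : set G, finite_set X ->
             end_component X w `&` U !=set0].

Section DeleteEdge.
Variables (G : graph) (x y : G).

Definition del_adj : rel G :=
  [rel a b | [&& adj a b, (a, b) != (x, y) & (a, b) != (y, x)]].

Lemma del_adj_sym : symmetric del_adj.
Proof.
move=> a b; rewrite /del_adj /= adj_sym !xpair_eqE.
by rewrite [(a == x) && _]andbC [(a == y) && _]andbC [X in _ && X]andbC.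
Qed.

Lemma del_adj_irrefl : irreflexive del_adj.
Proof. by move=> a; rewrite /del_adj /= adj_irrefl. Qed.

Definition del_edge : graph := Graph del_adj_sym del_adj_irrefl.

End DeleteEdge.

(* For an edge e = xy of T, this is T_x, the component of T - e containing x;
   T_y is side y x. *)
Definition side (T : graph) (x y : T) : set T :=
  [set t | @joined (del_edge x y) setT x t].

Record tree_decomposition (G : graph) := TreeDecomposition {
  td_tree : graph;
  td_treeP : is_tree td_tree;
  part : td_tree -> set G;
  part_vertex : forall v : G, exists t, part t v;
  part_edge : forall u v : G, adj u v -> exists t, part t u /\ part t v;
  part_path : forall (t1 t2 t3 : td_tree) (p : seq td_tree),
    is_path t1 t3 p -> t2 \in t1 :: p -> part t1 `&` part t3 `<=` part t2 }.

Section TreeDecomposition.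
Variables (G : graph) (D : tree_decomposition G).
Local Notation T := (td_tree D).

(* A_x for the edge xy of T; A_y is side_part y x. *)
Definition side_part (x y : T) : set G := \bigcup_(t in side x y) part t.

(* X_e for e = xy. *)
Definition adhesion_set (x y : T) : set G := part x `&` part y.

Definition finite_adhesion : Prop :=
  forall x y : T, adj x y -> finite_set (adhesion_set x y).

(* w orients the edge e = xy of T towards x: it lives in a component of
   G[A_x] - X_e. *)
Definition orients_towards (w : graph_end G) (x y : T) : Prop :=
  component (side_part x y `\` adhesion_set x y)
            (end_component (adhesion_set x y) w).

(* The orientation induced by w points towards a node t (resp. an end h) of T
   when every edge is oriented towards the side containing t (resp. a tail of
   every ray in h). *)
Definition points_towards (w : graph_end G) (z : T + graph_end T) : Prop :=
  forall x y : T, adj x y ->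
    match z with
    | inl t => side x y t
    | inr h => forall R, in_end R h -> tail_in R (side x y)
    end -> orients_towards w x y.

(* f is the map f_D; when D has finite adhesion there is exactly one such f. *)
Definition is_end_map (f : graph_end G -> T + graph_end T) : Prop :=
  forall w, points_towards w (f w).

Definition displays (Psi : set (graph_end G)) : Prop :=
  exists f, [/\ is_end_map f,
                Psi = f @^-1` range inr
              & set_bij Psi (range inr) f].

End TreeDecomposition.

(* Main.v *)
Require Import Defs.
From mathcomp Require Import all_boot.
From mathcomp Require Import boolp classical_sets functions cardinality.
From mathcomp Require Import zify.

(* For a vertex set E, let "limit E" be the set of ends in the closure of E. Call
   E of finite adhesion if all components of G - E have finite neighbourhoods.
   Every U lies in some E of finite adhesion with limit E = limit U: add to U a
   maximal disjoint family of rays of ends in limit U, then every vertex that no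
   finite set separates from the result; a component with infinite neighbourhood
   would contain a new ray of an end in limit U, by a star-comb argument.

   Starting from the empty set, alternately add a root and all neighbours and pass
   to such an envelope. This exhausts V(G) by sets E n of finite adhesion, and an
   end lies in some limit (E n) iff it is dominated. Put F n = E n together with the
   components of G - E n that avoid U. The components of G - F n, n >= 0, form a
   tree T under inclusion; the node C of level n gets the part
   F n.+1 & (C + N(C)). An end is sent to an end of T iff for every n it lives in a
   component of G - F n, that is, iff it lies in \partial U and is undominated. A
   descending chain of such components has empty intersection, hence contains
   exactly one end of G. *)

Set Implicit Arguments.
Unset Strict Implicit.
Unset Printing Implicit Defensive.

Local Open Scope classical_set_scope.

Definition nbhd (G : graph) (C : set G) : set G :=
  [set v | ~ C v /\ exists2 c, C c & adj c v].

Definition conn (G : graph) (K : set G) : Prop :=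
  forall x y, K x -> K y -> joined K x y.

(* The end of R lies in \partial B; see end_boundaryP. *)
Definition limit (G : graph) (B : set G) (R : ray G) : Prop :=
  forall X : set G, finite_set X ->
    exists n b, B b /\ joined (~` X) (R n) b.

Definition finite_adh (G : graph) (E : set G) : Prop :=
  forall C, component (~` E) C -> finite_set (nbhd C).

(** * Connectedness *)

Section Joined.
Variable G : graph.
Implicit Types (A B C K X : set G) (x y z : G).

Lemma joined_walk A x p : path adj x p -> (forall z, z \in x :: p -> A z) ->
  joined A x (last x p).
Proof.
move=> xp Ap; case/shortenP: xp => p' xp' up' sub.
exists p' => // z; rewrite inE => /predU1P[->|/sub zp]; apply: Ap.
  by rewrite mem_head.
by rewrite inE zp orbT.
Qed.

Lemma joined_refl A x : A x -> joined A x x.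
Proof. by move=> Ax; exists [::] => // z; rewrite inE => /eqP->. Qed.

Lemma joinedl A x y : joined A x y -> A x.
Proof. by case=> p _; apply; rewrite mem_head. Qed.

Lemma joinedr A x y : joined A x y -> A y.
Proof. by case=> p [_ _ <-]; apply; rewrite mem_last. Qed.

Lemma joined_trans A x y z : joined A x y -> joined A y z -> joined A x z.
Proof.
move=> [p [xp _ py] Ap] [q [yq _ qz] Aq].
rewrite -qz -py -last_cat; apply: joined_walk => [|t].
  by rewrite cat_path xp py.
rewrite -cat_cons mem_cat => /orP[/Ap//|tq].
by apply: Aq; rewrite inE tq orbT.
Qed.

Lemma joined_edge A x y : A x -> A y -> adj x y -> joined A x y.
Proof.
move=> Ax Ay xy; apply: (@joined_walk A x [:: y]); first by rewrite /= xy.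
by move=> z; rewrite !inE => /orP[]/eqP->.
Qed.

Lemma joined_ind A (S : set G) x y :
  S x -> (forall a b, S a -> A b -> adj a b -> S b) -> joined A x y -> S y.
Proof.
move=> Sx step [p [xp _ <-] Ap]; elim: p x Sx xp Ap => //= a p IH x Sx.
move=> /andP[xa ap] Ap; apply: (IH _ _ ap) => [|z zp].
  by apply: (step _ _ Sx _ xa); apply: Ap; rewrite !inE eqxx orbT.
by apply: Ap; rewrite inE zp orbT.
Qed.

Lemma joined_sym A x y : joined A x y -> joined A y x.
Proof.
move=> xy; have Ax := joinedl xy.
move: xy; apply: (@joined_ind A [set y | joined A y x]) => [|a b ax Ab ab].
  exact: joined_refl.
apply: (joined_trans _ ax); apply: joined_edge => //; last by rewrite adj_sym.
exact: joinedl ax.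
Qed.

Lemma joined_sub A B x y : A `<=` B -> joined A x y -> joined B x y.
Proof. by move=> AB [p Pp Ap]; exists p => // z /Ap/AB. Qed.

(** Each vertex of a path in A is itself joined to x in A, so the path stays inside the component of
    x; this makes components connected in themselves. *)
Lemma joined_comp A x y : joined A x y -> joined [set z | joined A x z] x y.
Proof.
move=> xy; have Ax := joinedl xy.
suff: ([set z | joined A x z /\ joined [set z | joined A x z] x z]) y by case.
apply: joined_ind xy => [|a b [xa xa'] Ab ab].
  by split; apply: joined_refl => //; apply: joined_refl.
have xb : joined A x b.
  by apply: (joined_trans xa); apply: joined_edge => //; exact: joinedr xa.
by split=> //; apply: (joined_trans xa' _); exact: joined_edge.
Qed.

Lemma conn_joined A x : conn [set y | joined A x y].
Proof.
move=> y z /joined_comp xy /joined_comp xz.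
exact: joined_trans (joined_sym xy) xz.
Qed.

Lemma component_of A x : A x -> component A [set y | joined A x y].
Proof. by exists x. Qed.

Lemma component_neq0 A C : component A C -> exists x, C x.
Proof. by case=> x Ax ->; exists x; apply: joined_refl. Qed.

Lemma component_conn A C : component A C -> conn C.
Proof. by case=> x Ax ->; apply: conn_joined. Qed.

Lemma component_sub A C : component A C -> C `<=` A.
Proof. by case=> x Ax -> y /joinedr. Qed.

Lemma component_joined A C x y : component A C -> C x -> joined A x y -> C y.
Proof. by case=> z Az -> /=; exact: joined_trans. Qed.

Lemma component_closed A C x y :
  component A C -> C x -> A y -> adj x y -> C y.
Proof.
move=> CC Cx Ay xy; apply: (component_joined CC Cx _).
exact: joined_edge (component_sub CC Cx) _ _.
Qed.

Lemma component_max A C K x :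
  component A C -> conn K -> K `<=` A -> C x -> K x -> K `<=` C.
Proof.
move=> CC cK KA Cx Kx y Ky; apply: (component_joined CC Cx _).
exact: joined_sub KA (cK _ _ Kx Ky).
Qed.

Lemma component_eq A C C' x :
  component A C -> component A C' -> C x -> C' x -> C = C'.
Proof.
move=> CC CC' Cx C'x; rewrite eqEsubset; split.
  exact: component_max CC' (component_conn CC) (component_sub CC) C'x Cx.
exact: component_max CC (component_conn CC') (component_sub CC') Cx C'x.
Qed.

Lemma componentI A C x : C x -> conn C -> C `<=` A ->
  (forall c v, C c -> A v -> adj c v -> C v) -> component A C.
Proof.
move=> Cx cC CA cl; exists x; first exact: CA.
rewrite eqEsubset; split=> y => [Cy|]; first exact: joined_sub CA (cC _ _ Cx Cy).
exact: joined_ind.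
Qed.

(** Lets a connected set with finite neighbourhood be treated as a component left by a finite
    separator, where ends can live. *)
Lemma component_nbhd C x : C x -> conn C -> component (~` nbhd C) C.
Proof.
move=> Cx cC; apply: (componentI Cx cC) => [y Cy []//|c v Cc nv cv].
by apply: contrapT => nCv; apply: nv; split=> //; exists c.
Qed.

Lemma nbhd_component A C : component A C -> nbhd C `<=` ~` A.
Proof.
by move=> CC v [nCv [c Cc cv]] Av; apply: nCv; apply: (component_closed CC Cc Av cv).
Qed.

Lemma component_subset A B C : component A C -> C `<=` B -> B `<=` A ->
  component B C.
Proof.
move=> CC CB BA; have [x Cx] := component_neq0 CC.
apply: (componentI Cx (component_conn CC) CB) => c v Cc /BA Av.
exact: component_closed CC Cc Av.
Qed.

Lemma conn_exit K (S : set G) x y : conn K -> K x -> K y -> S x -> ~ S y ->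
  exists a b, [/\ K a, K b, S a, ~ S b & adj a b].
Proof.
move=> cK Kx Ky Sx nSy; apply: contrapT => no; apply: nSy.
suff: ([set z | S z /\ K z]) y by case.
apply: joined_ind (cK _ _ Kx Ky) => // a b [Sa Ka] Kb ab.
by split=> //; apply: contrapT => nSb; apply: no; exists a, b.
Qed.

End Joined.

(** * Ends *)

Section Ends.
Variable G : graph.
Implicit Types (A B C K X : set G) (x y z : G) (R S : ray G) (w : graph_end G).

Lemma ray_avoid X R : finite_set X -> tail_in R (~` X).
Proof.
move=> /finite_seqP[s ->]; elim: s => [|a s [n IH]]; first by exists 0.
have [[k ka]|nka] := pselect (exists k, R k = a); last first.
  exists n => m /IH /= nm; rewrite inE => /orP[/eqP ma|//].
  by apply: nka; exists m.
exists (maxn n k.+1) => m; rewrite geq_max => /andP[/IH /= nm km].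
rewrite inE => /orP[/eqP|//]; rewrite -ka => /ray_inj mk.
by rewrite mk ltnn in km.
Qed.

Lemma finite_init R n : finite_set (R @` `I_n).
Proof. exact: finite_image. Qed.

Lemma init_avoid R n k : (~` (R @` `I_n)) (R k) -> n <= k.
Proof. by move=> h; rewrite leqNgt; apply/negP => kn; apply: h; exists k. Qed.

Lemma ray_joined A R m : (forall k, m <= k -> A (R k)) ->
  forall k, m <= k -> joined A (R m) (R k).
Proof.
move=> h k /subnK<-; elim: (k - m) => [|d IH].
  by apply: joined_refl; apply: h.
apply: (joined_trans IH _); rewrite addSn.
apply: joined_edge; last exact: ray_adj.
  by apply: h; apply: leq_addl.
by apply: h; rewrite -addSn; apply: leq_addl.
Qed.

Lemma tail_component X R : finite_set X ->
  exists C, component (~` X) C /\ tail_in R C.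
Proof.
move=> fX; have [m hm] := ray_avoid R fX.
exists [set y | joined (~` X) (R m) y]; split.
  by apply: component_of; apply: hm.
by exists m; apply: ray_joined.
Qed.

Lemma tail_meet R A B : tail_in R A -> tail_in R B -> exists n, A (R n) /\ B (R n).
Proof.
move=> [n An] [m Bm]; exists (maxn n m).
by split; [apply: An; apply: leq_maxl|apply: Bm; apply: leq_maxr].
Qed.

Lemma tail_sub R A B : A `<=` B -> tail_in R A -> tail_in R B.
Proof. by move=> AB [n h]; exists n => m /h/AB. Qed.

Lemma tail_unique A C C' R : component A C -> component A C' ->
  tail_in R C -> tail_in R C' -> C = C'.
Proof.
move=> CC CC' tC tC'; have [n [Cn C'n]] := tail_meet tC tC'.
exact: component_eq CC CC' Cn C'n.
Qed.

(** [ray_equiv] compares whole rays, so initial segments of both are deleted together with X; a path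
    that survives joins two tails. *)
Lemma equiv_tail X C R S : ray_equiv R S -> finite_set X ->
  component (~` X) C -> tail_in R C -> tail_in S C.
Proof.
move=> RS fX CC [n Cn]; have [m Sm] := ray_avoid S fX.
set Y := X `|` (R @` `I_n `|` S @` `I_m).
have fY : finite_set Y by rewrite !finite_setU; do !split => //; apply: finite_init.
have YX : ~` Y `<=` ~` X by move=> z nY Xz; apply: nY; left.
apply: contrapT => nt; apply: (RS Y fY) => _ _ [i _ <-] [j _ <-] ij; apply: nt.
have ni : n <= i.
  by apply: (@init_avoid R) => h; apply: (joinedl ij); right; left.
have mj : m <= j.
  by apply: (@init_avoid S) => h; apply: (joinedr ij); right; right.
exists j => k jk; apply: (component_joined CC (Cn _ ni) _).
apply: (joined_trans (joined_sub YX ij) _).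
by apply: ray_joined jk => l jl; apply: Sm; apply: leq_trans jl.
Qed.

Lemma equivI R S :
  (forall X, finite_set X ->
     exists K, [/\ conn K, K `<=` ~` X, tail_in R K & tail_in S K]) ->
  ray_equiv R S.
Proof.
move=> h X /h[K [cK KX [n Kn] [m Km]]] sep.
apply: (sep (R n) (S m)); [by exists n|by exists m|].
by apply: (joined_sub KX _); apply: cK; [apply: Kn|apply: Km].
Qed.

Lemma equiv_refl R : ray_equiv R R.
Proof.
apply: equivI => X fX; have [C [CC t]] := tail_component R fX.
by exists C; split=> //; [exact: component_conn CC|exact: component_sub CC].
Qed.

Lemma equiv_sym R S : ray_equiv R S -> ray_equiv S R.
Proof.
move=> RS; apply: equivI => X fX; have [C [CC t]] := tail_component R fX.
exists C; split=> //; [exact: component_conn CC|exact: component_sub CC|].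
exact: equiv_tail RS fX CC t.
Qed.

Lemma equiv_trans R S T : ray_equiv R S -> ray_equiv S T -> ray_equiv R T.
Proof.
move=> RS ST; apply: equivI => X fX; have [C [CC t]] := tail_component R fX.
exists C; split=> //; [exact: component_conn CC|exact: component_sub CC|].
exact: equiv_tail ST fX CC (equiv_tail RS fX CC t).
Qed.

Lemma end_ray w : exists R, in_end R w.
Proof.
by case: w => w [R Rw]; exists R; rewrite /in_end /= Rw; apply: equiv_refl.
Qed.

Lemma in_end_equiv w R S : in_end R w -> in_end S w -> ray_equiv R S.
Proof.
case: w => w [T Tw]; rewrite /in_end /= Tw /= => TR TS.
exact: equiv_trans (equiv_sym TR) TS.
Qed.

Definition end_of R : graph_end G :=
  exist _ [set S | ray_equiv R S] (ex_intro _ R erefl).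

Lemma in_end_of R : in_end R (end_of R).
Proof. exact: equiv_refl. Qed.

Lemma end_eq w w' R S : in_end R w -> in_end S w' -> ray_equiv R S -> w = w'.
Proof.
move=> Rw Sw' RS; suff ww' : sval w = sval w'.
  case: w w' ww' {Rw Sw'} => [w p] [w' p'] /= ww'.
  by rewrite ww' in p *; congr exist; apply: Prop_irrelevance.
case: w w' Rw Sw' => [w [P Pw]] [w' [Q Qw']]; rewrite /in_end /= Pw Qw' /=.
move=> PR QS; have PQ := equiv_trans (equiv_trans PR RS) (equiv_sym QS).
rewrite eqEsubset; split=> T /=; first exact: equiv_trans (equiv_sym PQ).
exact: equiv_trans PQ.
Qed.

(** One ray of the end suffices: for components left by finite sets, [lives_all] passes to all of
    them. *)
Definition lives w C : Prop := exists2 R, in_end R w & tail_in R C.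

Lemma lives_all X C w R : finite_set X -> component (~` X) C -> lives w C ->
  in_end R w -> tail_in R C.
Proof.
move=> fX CC [S Sw t] Rw.
exact: equiv_tail (in_end_equiv Sw Rw) fX CC t.
Qed.

Lemma end_componentE X C w : finite_set X -> component (~` X) C -> lives w C ->
  end_component X w = C.
Proof.
move=> fX CC lC; rewrite eqEsubset; split=> y; last first.
  by move=> Cy; exists C => //; split=> // R; exact: (lives_all fX CC lC).
move=> [C' [CC' h] C'y]; have [R Rw] := end_ray w.
by rewrite (tail_unique CC CC' (lives_all fX CC lC Rw) (h _ Rw)).
Qed.

Lemma end_componentP X w : finite_set X ->
  component (~` X) (end_component X w) /\ lives w (end_component X w).
Proof.
move=> fX; have [R Rw] := end_ray w.
have [C [CC t]] := tail_component R fX.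
have lC : lives w C by exists R.
by rewrite (end_componentE fX CC lC).
Qed.

Lemma end_boundaryP B w R : in_end R w -> end_boundary B w <-> limit B R.
Proof.
move=> Rw; split=> h X fX.
  have [CC lC] := end_componentP w fX.
  have [m Cm] := lives_all fX CC lC Rw.
  have [b [Cb Bb]] := h X fX; exists m, b; split=> //.
  apply: (joined_sub (component_sub CC) _).
  exact: component_conn CC _ _ (Cm _ (leqnn m)) Cb.
have [CC lC] := end_componentP w fX.
have [m Cm] := lives_all fX CC lC Rw.
(* Deleting the initial segment forces the vertex of R found next to lie in the tail inside the
   component. *)
have fY : finite_set (X `|` R @` `I_m).
  by rewrite finite_setU; split=> //; apply: finite_init.
have [n [b [Bb nb]]] := h _ fY; exists b; split=> //.
have mn : m <= n by apply: (@init_avoid R) => k; apply: (joinedl nb); right.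
apply: (component_joined CC (Cm _ mn) _); apply: (joined_sub _ nb) => z nz Xz.
by apply: nz; left.
Qed.

Lemma limit_component X C B R : finite_set X -> component (~` X) C ->
  tail_in R C -> limit B R -> exists2 b, C b & B b.
Proof.
move=> fX CC t /(proj2 (end_boundaryP B (@in_end_of R)))/(_ X fX)[b].
rewrite (end_componentE fX CC); first by case=> Cb Bb; exists b.
by exists R => //; apply: in_end_of.
Qed.

Lemma limit_not_live B C R : conn C -> finite_set (nbhd C) -> tail_in R C ->
  (forall b, C b -> ~ B b) -> ~ limit B R.
Proof.
move=> cC fN t nB lB; have [n Cn] := t.
have CC := component_nbhd (Cn n (leqnn n)) cC.
by have [b /nB] := limit_component fN CC t lB.
Qed.

Lemma not_limit_component E R : ~ limit E R -> exists X C,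
  [/\ finite_set X, component (~` X) C, tail_in R C & C `<=` ~` E].
Proof.
move=> nl; have [X [fX nX]] : exists X, finite_set X /\
    ~ exists n b, E b /\ joined (~` X) (R n) b.
  apply: contrapT => h; apply: nl => X fX; apply: contrapT => nX.
  by apply: h; exists X.
have [C [CC [m Cm]]] := tail_component R fX.
exists X, C; split=> //; first by exists m.
move=> b Cb Eb; apply: nX; exists m, b; split=> //.
apply: joined_sub (component_sub CC) _.
exact: component_conn CC _ _ (Cm _ (leqnn m)) Cb.
Qed.

(** E may be infinite here: a finite X leaves a component that avoids E and contains a tail of R,
    and this component lies in a single component of G - E. *)
Lemma not_limit_live E R : ~ limit E R ->
  exists C, component (~` E) C /\ tail_in R C.
Proof.
move=> /not_limit_component[X [C [fX CC [m Cm] CE]]].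
have Rm := Cm _ (leqnn m).
exists [set y | joined (~` E) (R m) y]; split; first exact: component_of (CE _ Rm).
exists m => k /Cm Ck; apply: joined_sub CE _; exact: component_conn CC _ _ Rm Ck.
Qed.

End Ends.

(** * Rays from nested connected sets *)

Lemma ex_least (P : nat -> Prop) : (exists n, P n) ->
  exists n, P n /\ forall m, P m -> n <= m.
Proof.
move=> [n Pn]; have exP : exists n, `[< P n >] by exists n; apply/asboolP.
case: (ex_minnP exP) => m /asboolP Pm min; exists m; split=> // k Pk.
by apply: min; apply/asboolP.
Qed.

Lemma infinite_seq (T : Type) (A : set T) : infinite_set A ->
  exists f : nat -> T, injective f /\ forall i, A (f i).
Proof.
move=> /infiniteP/card_leP[f].
exists (fun i => sval (f (exist _ i (mem_set I)))); split=> [i j ij|i]; last first.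
  by case: (f _) => x /= /set_mem.
have := @inj _ _ _ f _ _ (mem_set I) (mem_set I) (val_inj ij).
by case.
Qed.

Section Nested.
Variable G : graph.
Implicit Types (C E X : set G) (x y z : G) (R : ray G).

Lemma path_joined A x p z : path adj x p -> (forall t, t \in x :: p -> A t) ->
  z \in x :: p -> @joined G A x z.
Proof.
move=> xp Ap; rewrite inE => /predU1P[->|zp].
  by apply: joined_refl; apply: Ap; rewrite mem_head.
case/splitPr: p / zp xp Ap => p1 p2; rewrite -cat_rcons cat_path => /andP[xp _] Ap.
rewrite -[z](last_rcons x p1 z); apply: joined_walk xp _ => t tp.
by apply: Ap; rewrite -cat_cons mem_cat tp.
Qed.

Variable K : nat -> set G.
Hypothesis Kdec : forall n, K n.+1 `<=` K n.
Hypothesis Kcap : forall x, exists n, ~ K n x.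

Lemma nested_sub m n : m <= n -> K n `<=` K m.
Proof.
move=> /subnK<-; elim: (n - m) => [//|d IH] x.
by rewrite addSn => /Kdec/IH.
Qed.

Lemma nested_avoid X : finite_set X -> exists n, K n `<=` ~` X.
Proof.
move=> /finite_seqP[s ->]; elim: s => [|a s [n IH]]; first by exists 0 => x _.
have [m nm] := Kcap a; exists (maxn m n) => x Kx /=.
rewrite inE => /orP[/eqP xa|xs].
  by apply: nm; rewrite -xa; apply: nested_sub Kx; apply: leq_maxl.
by apply: (IH x) => //; apply: nested_sub Kx; apply: leq_maxr.
Qed.

Hypothesis Kconn : forall n, conn (K n).
Hypothesis K0 : forall n, exists x, K n x.

(* From x, step along a shortest walk to the next set of the sequence. The pair
   (number of sets containing x, distance to the next set) then changes
   lexicographically, so that no vertex is visited twice. *)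
Lemma nested_ray : exists R : ray G,
  (forall n, K 0 (R n)) /\ forall n, tail_in R (K n).
Proof.
(* [h x] is the index of the first set missing x; as the sets decrease, x lies exactly in those of
   smaller index. *)
have /choice[h hP] x : exists m, ~ K m x /\ forall j, ~ K j x -> m <= j.
  exact: ex_least (Kcap x).
have hK x j : j < h x -> K j x.
  by move=> jh; apply: contrapT => /(proj2 (hP x)); rewrite leqNgt jh.
have Kh x j : K j x -> j < h x.
  move=> Kj; rewrite ltnNge; apply/negP => hj.
  exact: (proj1 (hP x)) (nested_sub hj Kj).
(* A walk of length l from x to the next set that stays in the last set containing x. This is used
   for x in [K 0] only, where [h x] is positive. *)
pose D x l := exists p, [/\ path adj x p, size p = l,
  forall z, z \in x :: p -> K (h x).-1 z & K (h x) (last x p)].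
have /choice[d dP] x : exists l, K 0 x -> D x l /\ forall l', D x l' -> l <= l'.
  have [K0x|nK] := pselect (K 0 x); last by exists 0.
  have [|l [Dl lmin]] := @ex_least (D x); last by exists l.
  have [y Ky] := K0 (h x); have hx := Kh _ _ K0x.
  have [||p [xp _ py] pK] := @Kconn (h x).-1 x y.
  - by apply: hK; lia.
  - by apply: nested_sub Ky; lia.
  by exists (size p), p; split=> //; rewrite py.
have /choice[s sP] x : exists y, K 0 x ->
    [/\ adj x y, K 0 y & h x < h y \/ h x = h y /\ d y < d x].
  have [K0x|nK] := pselect (K 0 x); last by exists x.
  have hx := Kh _ _ K0x.
  have [[[|y p] [/= xp sz pK Kl]] _] := dP x K0x; first by case: (proj1 (hP x)).
  have Ky : K (h x).-1 y by apply: pK; rewrite !inE eqxx orbT.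
  have hy := Kh _ _ Ky; have K0y : K 0 y by apply: nested_sub Ky.
  move: xp => /andP[xy yp]; exists y => _; split=> //.
  have [|nlt] := ltnP (h x) (h y); first by left.
  have e : h x = h y by lia.
  right; split=> //; rewrite -sz; apply: (proj2 (dP y K0y)).
  exists p; split=> //; rewrite -e // => z zp.
  by apply: pK; rewrite inE zp orbT.
have [x0 Kx0] := K0 0; pose r n := iter n s x0.
have rK n : K 0 (r n) by elim: n => //= n /sP[].
have rS n : h (r n) < h (r n.+1) \/ h (r n) = h (r n.+1) /\ d (r n.+1) < d (r n).
  by case: (sP _ (rK n)).
have rlt m k : h (r m) < h (r (k + m.+1)) \/
    h (r m) = h (r (k + m.+1)) /\ d (r (k + m.+1)) < d (r m).
  elim: k => [|k IH]; first exact: rS.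
  by rewrite addSn; have := rS (k + m.+1); lia.
have rinj : injective r.
  have lt m n : m < n -> r m <> r n.
    by move=> mn e; have := rlt m (n - m.+1); rewrite subnK // -e; lia.
  move=> m n e; case: (ltngtP m n) => // /lt; first by move/(_ e).
  by move=> h'; case: h'.
have radj n : adj (r n) (r n.+1) by case: (sP _ (rK n)).
exists (Ray rinj radj); split=> // i /=.
have hmono m n : m <= n -> h (r m) <= h (r n).
  rewrite leq_eqVlt => /orP[/eqP-> //|mn].
  by have := rlt m (n - m.+1); rewrite subnK //; lia.
suff [n hn] : exists n, i < h (r n).
  by exists n => m nm; apply: hK; apply: leq_trans (hmono _ _ nm).
elim: i => [|i [n hn]]; first by exists 0; apply: Kh.
(* While h is constant the distance d drops, so induction on d reaches a step at which h grows. *)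
have [k] := ubnP (d (r n)); elim: k n hn => // k IH n hn dk.
have [hS|[e dS]] := rS n; first by exists n.+1; lia.
by apply: (IH n.+1); lia.
Qed.

End Nested.

Lemma exhaustion_avoid (G : graph) (F : nat -> set G) (X : set G) :
  (forall n, F n `<=` F n.+1) -> (forall x, exists n, F n x) ->
  finite_set X -> exists n, X `<=` F n.
Proof.
move=> Finc Fcov fX.
have nF v : exists n, ~ (~` F n) v by have [n Fv] := Fcov v; exists n; apply.
have [n nX] :=
  @nested_avoid G (fun n => ~` F n) (fun n => subsetC (@Finc n)) nF X fX.
by exists n => x Xx; apply: contrapT => /nX.
Qed.

(** * Combs and envelopes *)

Section Envelope.
Variable G : graph.
Implicit Types (C E U X : set G) (x y z : G) (R : ray G).

(** The comb case of the star-comb lemma: a star with infinitely many leaves in E is excluded, as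
    every vertex of C is finitely separated from E. Decreasing connected subsets of C, each with
    infinitely many neighbours in E, yield the spine R through [nested_ray]. *)
Lemma comb C E : conn C ->
  (forall c, C c -> exists X,
     [/\ finite_set X, ~ X c & forall e, E e -> ~ joined (~` X) c e]) ->
  infinite_set [set e | E e /\ exists2 c, C c & adj c e] ->
  exists R : ray G, (forall n, C (R n)) /\ limit E R.
Proof.
move=> cC sepE /infinite_seq[f [finj fP]].
have /choice[Y_ YP] c : exists X, C c ->
    [/\ finite_set X, ~ X c & forall e, E e -> ~ joined (~` X) c e].
  have [/sepE[X XP]|nC] := pselect (C c); first by exists X.
  by exists set0.
have noedge x k i : C x -> joined (~` Y_ x) x k -> adj k (f i) -> Y_ x (f i).
  move=> /YP[_ _ nE] xk ki; apply: contrapT => nY.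
  apply: (nE _ (proj1 (fP i))); apply: (joined_trans xk).
  by apply: joined_edge => //; apply: joinedr xk.
pose ind (K : set G) := [set i | exists2 k, K k & adj k (f i)].
pose big K := [/\ K `<=` C, conn K & infinite_set (ind K)].
have fpre X : finite_set X -> finite_set [set i | X (f i)].
  by move=> fX; apply: finite_preimage fX => i j _ _ /finj.
(* If i is not in the finite set of indices with f i in Y, a neighbour k of f i
   in K lies neither in X nor in a component of K - X avoiding Y: otherwise some
   x in X would be joined to f i outside Y_ x. So finitely many components of
   K - X cover the remaining indices. *)
have shrink (u : set G * set G) : exists K', big u.1 -> finite_set u.2 ->
    [/\ big K', K' `<=` u.1 & K' `<=` ~` u.2].
  case: u => K X /=.
  have [[[KC cK infK] fX]|] := pselect (big K /\ finite_set X); last first.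
    by move=> h; exists set0 => bK fX; case: h.
  suff [K' h] : exists K', [/\ big K', K' `<=` K & K' `<=` ~` X] by exists K'.
  (* If K misses X it can be kept. Otherwise connectedness of K gives every component of K - X an
     edge into X. *)
  have [[x0 [Kx0 Xx0]]|dis] := pselect (exists x0, K x0 /\ X x0); last first.
    by exists K; split=> // x Kx Xx; apply: dis; exists x.
  pose Y := X `|` \bigcup_(x in X `&` C) Y_ x.
  have fY : finite_set Y.
    rewrite finite_setU; split=> //; apply: bigcup_finite.
      by apply: sub_finite_set fX => z [].
    by move=> x [_ /YP[]].
  have YY x z : X x -> C x -> Y_ x z -> Y z by move=> Xx Cx Yz; right; exists x.
  pose Q y := [set z | joined (K `\` X) y z].
  suff [y [Yy infQ]] : exists y, Y y /\ infinite_set (ind (Q y)).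
    exists (Q y); split.
    - split=> //; last exact: conn_joined.
      by move=> z /joinedr[/KC].
    - by move=> z /joinedr[].
    - by move=> z /joinedr[].
  apply: contrapT => noy; apply: infK.
  apply: (@sub_finite_set _ _ ([set i | Y (f i)] `|` \bigcup_(y in Y) ind (Q y))).
    move=> i [k Kk ki]; have [Yi|nYi] := pselect (Y (f i)); [by left|right].
    have [Xk|nXk] := pselect (X k).
      case: nYi; apply: (YY k) => //; first exact: KC.
      apply: (noedge k k) => //; first exact: KC.
      by apply: joined_refl; case: (YP _ (KC _ Kk)).
    have [[y [Qy Yy]]|nQ] := pselect (exists y, Q k y /\ Y y).
      by exists y => //; exists k => //; apply: joined_sym.
    have Qk : Q k k by apply: joined_refl.
    have nQx0 : ~ Q k x0 by move=> /joinedr[].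
    have [a [b [Ka Kb Qa nQb ab]]] := conn_exit cK Kk Kx0 Qk nQx0.
    have Xb : X b.
      apply: contrapT => nXb; apply: nQb; apply: (joined_trans Qa).
      by apply: joined_edge => //; apply: joinedr Qa.
    case: nYi; apply: (YY b) => //; first exact: KC.
    have QY : Q k `<=` ~` Y_ b.
      move=> z Qz Yz; apply: nQ; exists z; split=> //.
      by apply: (YY b) => //; apply: KC.
    apply: (noedge b k) => //; first exact: KC.
    apply: (@joined_trans _ _ _ a).
      apply: joined_edge; [by case: (YP _ (KC _ Kb))|exact: QY|by rewrite adj_sym].
    by apply: (joined_sub QY); apply: conn_joined.
  rewrite finite_setU; split; first exact: fpre.
  apply: bigcup_finite => // y Yy; apply: contrapT => infQ; apply: noy.
  by exists y.
have [sh shP] := choice shrink.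
have [c0 Cc0 _] := proj2 (fP 0).
have /choice[Q QP] i : exists p, [/\ path adj c0 p, forall z, z \in c0 :: p -> C z
    & adj (last c0 p) (f i)].
  have [c Cc ci] := proj2 (fP i); have [p [xp _ pc] pC] := cC _ _ Cc0 Cc.
  by exists p; split=> //; rewrite pc.
(* C may be uncountable, so the construction is confined to countably many paths that reach
   neighbours of all the [f i]; deleting the n-th path at stage n empties the intersection of the
   sets [K n]. *)
pose C' := [set z | exists i, z \in c0 :: Q i].
have C'0 z : C' z -> joined C' c0 z.
  move=> [i zi]; have [xp _ _] := QP i.
  by apply: (path_joined xp) => // t ti; exists i.
have bC' : big C'.
  split=> [z [i zi]|x y /C'0 xx /C'0 yy|]; first by case: (QP i) => _ /(_ z zi).
    exact: joined_trans (joined_sym xx) yy.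
  move=> fin; apply: infinite_nat; apply: sub_finite_set fin => i _.
  by case: (QP i) => _ _ ad; exists (last c0 (Q i)) => //; exists i; apply: mem_last.
pose K := fix K n := if n is m.+1 then sh (K m, [set` c0 :: Q m]) else C'.
have fS (s : seq G) : finite_set [set` s] by apply/finite_seqP; exists s.
have bK n : big (K n).
  by elim: n => // n IH /=; case: (shP (K n, [set` c0 :: Q n]) IH (fS _)).
have KS n : K n.+1 `<=` K n /\ K n.+1 `<=` ~` [set` c0 :: Q n].
  by case: (shP (K n, [set` c0 :: Q n]) (bK n) (fS _)).
have Kcap x : exists n, ~ K n x.
  have [[i xi]|nx] := pselect (C' x); last by exists 0.
  by exists i.+1 => /(proj2 (KS i)); apply.
have Kdec n : K n.+1 `<=` K n by case: (KS n).
have Kne n : exists x, K n x.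
  case: (bK n) => _ _ inf; apply: contrapT => no; apply: inf.
  by apply: (@sub_finite_set _ _ set0) => // i [k Kk _]; apply: no; exists k.
have [|R [R0 Rt]] := nested_ray Kdec Kcap _ Kne; first by move=> n; case: (bK n).
exists R; split=> [n|X fX]; first by case: bC' => + _ _; apply; apply: R0.
have [n KX] := nested_avoid Kdec Kcap fX.
have [m Rm] := Rt n; have [_ cK inf] := bK n.
have [i [[k Kk ki] nXi]] : exists i, ind (K n) i /\ ~ X (f i).
  apply: contrapT => no; apply: inf; apply: sub_finite_set (fpre X fX) => i indi /=.
  by apply: contrapT => nX; apply: no; exists i.
exists m, (f i); split; first by case: (fP i).
apply: (@joined_trans _ _ _ k).
  by apply: joined_sub KX _; apply: cK => //; apply: Rm.
by apply: joined_edge => //; apply: KX.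
Qed.

Lemma envelope U : exists E, [/\ U `<=` E, finite_adh E
  & forall R, limit E R -> limit U R].
Proof.
have [F [Fsub Ftriv Fmax]] :=
  @ex_maximal_disjoint_subcollection _ _ (fun R : ray G => range R) [set R | limit U R].
pose W := U `|` \bigcup_(R in F) range R.
have limW R : limit W R -> limit U R.
  move=> lW; apply: contrapT => /not_limit_component[X [C [fX CC tC CU]]].
  have noF S : F S -> ~ tail_in S C.
    by move=> /Fsub lS tS; have [b /CU] := limit_component fX CC tS lS.
  (* A ray of F that meets C but not X would have a tail in C. By disjointness only finitely many
     rays of F meet X, and each meets C only within an initial segment, so Z is finite. *)
  pose Z := C `&` \bigcup_(S in F) range S.
  have fZ : finite_set Z.
    pose FX := \bigcup_(x in X) [set S | F S /\ range S x].
    apply: (@sub_finite_set _ _ (\bigcup_(S in FX) (C `&` range S))).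
      move=> z [Cz [S FS Sz]]; exists S => //.
      apply: contrapT => nFX; apply: (noF _ FS).
      have SX n : (~` X) (S n).
        by move=> XS; apply: nFX; exists (S n) => //; split=> //; exists n.
      case: Sz => n _ nz; exists n => m nm; apply: component_joined CC Cz _.
      by rewrite -nz; apply: ray_joined nm => k _.
    apply: bigcup_finite => [|S [x Xx [FS _]]].
      apply: bigcup_finite => // x _.
      have [[S [FS Sx]]|no] := pselect (exists S, F S /\ range S x); last first.
        by apply: (@sub_finite_set _ _ set0) => // S h; apply: no; exists S.
      apply: (@sub_finite_set _ _ [set S]) => // S' [FS' S'x] /=.
      by apply: Ftriv => //; exists x.
    have [C' [CC' [m tC']]] := tail_component S fX.
    apply: sub_finite_set (finite_init S m) => z [Cz [n _ nz]]; exists n => //=.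
    rewrite ltnNge; apply/negP => mn; apply: (noF _ FS); rewrite -nz in Cz.
    by rewrite (component_eq CC CC' Cz (tC' _ mn)); exists m.
  have fY : finite_set (X `|` Z) by rewrite finite_setU.
  have [C2 [CC2 t2]] := tail_component R fY.
  have [b C2b Wb] := limit_component fY CC2 t2 lW.
  have nb : (~` (X `|` Z)) b by apply: (component_sub CC2).
  have [n [Cn C2n]] := tail_meet tC t2.
  have Cb : C b.
    apply: (component_max CC (component_conn CC2) _ Cn C2n) C2b => z.
    by move=> /(component_sub CC2) nz Xz; apply: nz; left.
  by case: Wb => [/(CU _ Cb)//|Rb]; apply: nb; right.
pose E := [set v | forall X, finite_set X -> ~ X v ->
  exists b, W b /\ joined (~` X) v b].
have WE : W `<=` E by move=> v Wv X _ nX; exists v; split=> //; apply: joined_refl.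
have limE R : limit E R -> limit W R.
  move=> lE X fX; have [n [e [Ee ne]]] := lE X fX.
  have [b [Wb eb]] := Ee X fX (joinedr ne).
  by exists n, b; split=> //; apply: joined_trans ne eb.
exists E; split=> [v Uv|C CC|R /limE/limW//]; first by apply: WE; left.
(* A comb found in C has its end in [limit U], while its spine avoids E and hence all rays of F;
   adding it to F contradicts maximality. *)
apply: contrapT => inf; have [||R [RC lR]] := @comb C E (component_conn CC).
(* A finite set separating c from W separates it from E too, since a vertex of E outside this set is
   still joined to W. *)
- move=> c /(component_sub CC) nEc; apply: contrapT => no; apply: nEc => X fX nXc.
  apply: contrapT => nob; apply: no; exists X; split=> // e Ee ce; apply: nob.
  have [b [Wb eb]] := Ee X fX (joinedr ce).
  by exists b; split=> //; apply: joined_trans ce eb.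
- move=> fin; apply: inf; apply: sub_finite_set fin => v nv; split; last by case: nv.
  by apply: contrapT; apply: (nbhd_component CC nv).
have RF S m n : F S -> R m <> S n.
  move=> FS e; apply: (component_sub CC (RC m)).
  by apply: WE; right; exists S => //; exists n.
apply: (Fmax (F `|` [set R])).
- split=> [S FS|RsubF]; first by left.
  by have /(RF R 0 0) := RsubF R (or_intror erefl).
- by move=> S [/Fsub//|->]; apply: limW; apply: limE.
move=> S S' [FS|->] [FS'|->] [z [[m _ mz] [n _ nz]]] //.
- by apply: Ftriv => //; exists z; split; [exists m|exists n].
- by case: (@RF S n m); rewrite // mz nz.
- by case: (@RF S' m n); rewrite // mz nz.
Qed.

End Envelope.

(** * Dominated ends *)

Section Domination.
Variable G : graph.
Implicit Types (C E U X : set G) (v x y z : G) (R : ray G) (w : graph_end G).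

(* v cannot be finitely separated from the tails of R: dominates_ray v R without
   reference to paths. *)
Definition linked v R : Prop := forall X C, finite_set X -> ~ X v ->
  component (~` X) C -> tail_in R C -> C v.

Lemma linked_path v R (s : seq G) : linked v R ->
  exists p, [/\ p <> [::], is_path v (last v p) p, range R (last v p)
              & forall z, z \in p -> z \notin s].
Proof.
(* The vertex v is spared from deletion, since the path has to start there. *)
move=> lv; set X := [set z | z \in s /\ z != v].
have fX : finite_set X.
  by apply: (@sub_finite_set _ _ [set` s]) => [z []//|]; apply/finite_seqP; exists s.
have nXv : ~ X v by move=> [_]; rewrite eqxx.
have [C [CC tC]] := tail_component R fX.
(* A target different from v makes the path nonempty. *)
have [n [Cn nv]] := tail_meet tC (ray_avoid R (finite_set1 v)).
have Cv := lv X C fX nXv CC tC.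
have [p [vp up pn] pC] := component_conn CC Cv Cn.
exists p; split=> [p0||//|z zp].
- by apply: nv; rewrite /= -pn p0.
- by split.
- by exists n.
apply/negP => zs; apply: (component_sub CC (pC z _)); first by rewrite inE zp orbT.
by split=> //; apply/eqP => zv; move: up; rewrite /= -zv zp.
Qed.

Lemma linked_dominates v R : linked v R -> dominates_ray v R.
Proof.
move=> lv; have /choice[nx nxP] s := linked_path s lv.
(* [acc n] collects the vertices of the first n paths, and the next path is chosen to avoid them. *)
pose acc := fix acc n := if n is m.+1 then nx (acc m) ++ acc m else [::].
have accP i k z : z \in nx (acc i) -> z \in acc (k + i.+1).
  by move=> zi; elim: k => [|k IH]; rewrite ?addSn /= mem_cat ?zi ?IH ?orbT.
have dis i j z : i < j -> z \in nx (acc i) -> z \notin nx (acc j).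
  move=> ij zi; apply/negP => zj; have [_ _ _ /(_ z zj)/negP] := nxP (acc j).
  by apply; have := accP i (j - i.+1) z zi; rewrite subnK.
exists (fun i => nx (acc i)); split=> [i|i|i|i j z ij]; try by case: (nxP (acc i)).
by case: (ltngtP i j) => // lij; [exact: dis|apply: contraTN; exact: dis].
Qed.

(** If no vertex is linked to R, each vertex of the finite set X + r is finitely separated from a
    tail of R. Once all these separators are deleted as well, a neighbour b of E reached from the
    tail cannot have its neighbour e of E in X, so e is reached outside X. *)
Lemma limit_nbhd r E R : limit (r |` (E `|` nbhd E)) R ->
  limit E R \/ exists v, linked v R.
Proof.
move=> lR; have [?|nov] := pselect (exists v, linked v R); [by right|left].
have /choice[Y_ YP] x : exists Y, [/\ finite_set Y, ~ Y x & exists C,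
    [/\ component (~` Y) C, tail_in R C & ~ C x]].
  apply: contrapT => no; apply: nov; exists x => X C fX nX CC tC.
  by apply: contrapT => nC; apply: no; exists X; split=> //; exists C.
move=> X fX; set X' := r |` X.
have fX' : finite_set X' by rewrite finite_setU; split=> //; apply: finite_set1.
have fZ : finite_set (X' `|` \bigcup_(x in X') Y_ x).
  rewrite finite_setU; split=> //; apply: bigcup_finite => // x _.
  by case: (YP x).
have [C [CC tC]] := tail_component R fZ.
have [b Cb Eb] := limit_component fZ CC tC lR.
have CX : C `<=` ~` X by move=> z /(component_sub CC) nz Xz; apply: nz; left; right.
have [n Cn] := tail_meet tC tC.
have nb : joined (~` X) (R n) b.
  by apply: joined_sub CX _; apply: (component_conn CC) => //; case: Cn.
case: Eb => [br|[Eb|[nEb [e Ee eb]]]]; last 1 first.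
- exists n, e; split=> //; apply: (joined_trans nb).
  apply: joined_edge; [exact: CX| |by rewrite adj_sym].
  move=> Xe; have [_ nYe [D [CD tD nDe]]] := YP e; apply: nDe.
  have CY : C `<=` ~` Y_ e.
    by move=> z /(component_sub CC) nz Yz; apply: nz; right; exists e => //; right.
  have [m [Cm Dm]] := tail_meet tC tD.
  have Db := component_max CD (component_conn CC) CY Dm Cm Cb.
  by apply: (component_closed CD Db nYe); rewrite adj_sym.
- by case: (component_sub CC Cb); left; left.
- by exists n, b.
Qed.

(** A finite X meets only finitely many of the paths, which are disjoint apart from v. A path whose
    vertices after v avoid X joins a neighbour of v to the ray outside X. *)
Lemma dominated_limit E v w R : E v -> dominates_end v w -> in_end R w ->
  limit (E `|` nbhd E) R.
Proof.
move=> Ev [S Sw [P [Pne Ppath PS Pdis]]] Rw.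
apply/(end_boundaryP _ Rw)/(end_boundaryP _ Sw) => X fX.
have [i iX] : exists i, forall z, z \in P i -> ~ X z.
  apply: contrapT => no.
  have /choice[z zP] i : exists z, z \in P i /\ X z.
    apply: contrapT => noz; apply: no; exists i => z zi Xz.
    by apply: noz; exists z.
  apply: infinite_nat; apply: (@sub_finite_set _ _ (z @^-1` X)).
    by move=> i _ /=; case: (zP i).
  apply: finite_preimage => // i j _ _ zij; apply: contrapT => ij.
  have := Pdis i j (z i) ij (proj1 (zP i)).
  by rewrite zij (proj1 (zP j)).
have [n _ nl] := PS i; case: (P i) (Pne i) (Ppath i) iX nl => // a p _.
move=> [/= /andP[va ap] _ _] iX nl; exists n, a; split.
  have [|nEa] := pselect (E a); [by left|by right; split=> //; exists v].
by rewrite nl; apply: joined_sym; apply: joined_walk ap _ => z /iX.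
Qed.

Hypothesis hG : connected_graph G.

Lemma finite_adh_set0 : finite_adh (@set0 G).
Proof.
move=> C CC; apply: (@sub_finite_set _ _ set0) => // x /(nbhd_component CC) nx.
by apply: nx.
Qed.

(** A vertex in [E n] that dominates an end puts it into the limit of [E n.+1]. Conversely,
    envelopes add no ends, and by [limit_nbhd] the root and the neighbours add only dominated
    ones. *)
Lemma dominated_exhaustion : exists E : nat -> set G,
  [/\ E 0 = set0, forall n, E n `<=` E n.+1, forall x, exists n, E n x,
      forall n, finite_adh (E n)
    & forall w R, in_end R w -> dominated w <-> exists n, limit (E n) R].
Proof.
have [[r] Gconn] := hG.
have /choice[env envP] := @envelope G.
pose E := fix E n := if n is m.+1 then env (r |` (E m `|` nbhd (E m))) else set0.
have ES n : r |` (E n `|` nbhd (E n)) `<=` E n.+1.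
  by case: (envP (r |` (E n `|` nbhd (E n)))).
have inc n : E n `<=` E n.+1 by move=> x Ex; apply: ES; right; left.
have cov x : exists n, E n x.
  apply: (@joined_ind G setT [set x | exists n, E n x]) (Gconn r x).
    by exists 1; apply: ES; left.
  move=> a b [n Ea] _ ab; have [Eb|nEb] := pselect (E n b); first by exists n.
  by exists n.+1; apply: ES; right; right; split=> //; exists a.
exists E; split=> // [[|n]|w R Rw].
- exact: finite_adh_set0.
- by case: (envP (r |` (E n `|` nbhd (E n)))).
split=> [[v vw]|[n]].
  have [n Ev] := cov v; exists n.+1 => X fX.
  have [m [b [Eb mb]]] := dominated_limit Ev vw Rw fX.
  by exists m, b; split=> //; apply: ES; right.
elim: n => [/(_ set0 (finite_set0 _))[n [b []]]//|n IH].
case: (envP (r |` (E n `|` nbhd (E n)))) => _ _ limE /limE/limit_nbhd[//|[v lv]].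
by exists v, R => //; apply: linked_dominates.
Qed.

(** The components of G - [F n] are the components of G - [E n] that meet U. An undominated end
    lives in some component of G - [E n], whose finite neighbourhood forces it to meet U if the end
    lies in the closure of U. *)
Lemma boundary_exhaustion U : (exists u, U u) -> exists F : nat -> set G,
  [/\ F 0 = set0, forall n, F n `<=` F n.+1, forall x, exists n, F n x,
      forall n, finite_adh (F n)
    & forall w, (end_boundary U w /\ ~ dominated w) <->
        forall n, exists C, component (~` F n) C /\ lives w C].
Proof.
move=> [u0 Uu0]; have [E [E0 Einc Ecov Eadh Edom]] := dominated_exhaustion.
(* This includes [E n], since its vertices are joined to nothing in the complement of [E n]. *)
pose F n := [set v | forall u, U u -> ~ joined (~` E n) v u].
have EF n : E n `<=` F n by move=> x Ex u Uu /joinedl.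
have Finc n : F n `<=` F n.+1.
  move=> x Fx u Uu xu; apply: (Fx u Uu); apply: joined_sub xu => z nz Ez.
  by apply: nz; apply: Einc.
have fill n C u : component (~` E n) C -> C u -> U u -> component (~` F n) C.
  move=> CC Cu Uu; apply: (component_subset CC) => [x Cx Fx|x nFx /EF//].
  apply: (Fx u Uu); apply: joined_sub (component_sub CC) _.
  exact: (component_conn CC).
have unfill n C : component (~` F n) C ->
    component (~` E n) C /\ exists2 u, C u & U u.
  move=> CC; have [x Cx] := component_neq0 CC.
  have [u [Uu xu]] : exists u, U u /\ joined (~` E n) x u.
    apply: contrapT => no; apply: (component_sub CC Cx) => u Uu xu.
    by apply: no; exists u.
  have C'C := component_of (joinedl xu).
  have xx := joined_refl (joinedl xu).
  rewrite (component_eq CC (fill n _ u C'C xu Uu) Cx xx).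
  by split=> //; exists u.
have Fcov x : exists n, F n x by have [n Ex] := Ecov x; exists n; apply: EF.
exists F; split=> //.
- rewrite -subset0 => x /(_ u0 Uu0); rewrite E0 setC0; apply.
  exact: (proj2 hG).
- by move=> n C /unfill[/Eadh].
move=> w; have [R Rw] := end_ray w; split=> [[wU nd] n|h].
  have [|C [CC tC]] := @not_limit_live G (E n) R.
    by move=> lE; apply: nd; apply/(Edom w R Rw); exists n.
  exists C; split; last by exists R.
  have [x Cx] := component_neq0 CC; have fN := Eadh _ _ CC.
  have CN := component_nbhd Cx (component_conn CC).
  have [u Cu Uu] := limit_component fN CN tC (proj1 (end_boundaryP _ Rw) wU).
  exact: fill CC Cu Uu.
have live n : exists C, [/\ component (~` F n) C, component (~` E n) C,
    tail_in R C & exists2 u, C u & U u].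
  have [C [CC lC]] := h n; have [CC' Cu] := unfill n C CC; exists C; split=> //.
  have [x Cx] := component_neq0 CC.
  exact: lives_all (Eadh _ _ CC') (component_nbhd Cx (component_conn CC)) lC Rw.
split.
  apply/(end_boundaryP _ Rw) => X fX.
  have [n nX] := exhaustion_avoid Finc Fcov fX.
  have [C [CC _ tC [u Cu Uu]]] := live n.
  have [m [Cm _]] := tail_meet tC tC; exists m, u; split=> //.
  apply: joined_sub (component_conn CC Cm Cu).
  by move=> z /(component_sub CC) nz /nX.
move=> /(Edom w R Rw)[n]; have [C [_ CC tC _]] := live n.
apply: (limit_not_live (component_conn CC) (Eadh _ _ CC) tC).
exact: component_sub CC.
Qed.

End Domination.

(** * The tree of components *)

Section Tree.
Variables (G : graph) (F : nat -> set G).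
Hypothesis hG : connected_graph G.
Hypothesis F0 : F 0 = set0.
Hypothesis Finc : forall n, F n `<=` F n.+1.
Hypothesis Fcov : forall x, exists n, F n x.
Hypothesis Fadh : forall n, finite_adh (F n).

(** The level is part of a node, because one vertex set can be a component at several levels; for
    the same reason [below] compares levels as well as sets. *)
Definition node := {t : nat * set G | `[< component (~` F t.1) t.2 >]}.
Definition lvl (t : node) : nat := (val t).1.
Definition cmp (t : node) : set G := (val t).2.
Implicit Types (s t p x y : node) (v : G) (w : graph_end G).

Definition child p s : Prop := lvl s = (lvl p).+1 /\ cmp s `<=` cmp p.
Definition below t : set node := [set s | lvl t <= lvl s /\ cmp s `<=` cmp t].
Definition cl t : set G := cmp t `|` nbhd (cmp t).

Lemma cmpP t : component (~` F (lvl t)) (cmp t).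
Proof. exact: (asboolW (valP t)). Qed.

Lemma F_sub m n : m <= n -> F m `<=` F n.
Proof.
move=> /subnK<-; elim: (n - m) => [//|d IH] a.
by rewrite addSn => /IH/Finc.
Qed.

Lemma cmp_neq0 t : exists a, cmp t a.
Proof. exact: component_neq0 (cmpP t). Qed.

Lemma cmp_conn t : conn (cmp t).
Proof. exact: component_conn (cmpP t). Qed.

Lemma cmp_F t a : cmp t a -> ~ F (lvl t) a.
Proof. exact: component_sub (cmpP t) a. Qed.

Lemma nbhd_F t : nbhd (cmp t) `<=` F (lvl t).
Proof. by move=> a /(nbhd_component (cmpP t))/contrapT. Qed.

Lemma cmp_component t : component (~` nbhd (cmp t)) (cmp t).
Proof. by have [a ta] := cmp_neq0 t; apply: component_nbhd ta (@cmp_conn t). Qed.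

Lemma finite_nbhd t : finite_set (nbhd (cmp t)).
Proof. exact: Fadh (cmpP t). Qed.

Lemma node_of n a : ~ F n a -> exists t, lvl t = n /\ cmp t a.
Proof.
move=> nF; have h := @component_of _ (~` F n) a nF.
exists (exist _ (n, [set b | joined (~` F n) a b]) (asboolT h)); split=> //.
exact: joined_refl.
Qed.

Lemma node_eq s t a : lvl s = lvl t -> cmp s a -> cmp t a -> s = t.
Proof.
case: s t => [[m C] hC] [[n D] hD]; rewrite /lvl /cmp /= => mn Ca Da.
apply: val_inj => /=; congr pair => //; rewrite -mn in hD.
exact: component_eq (asboolW hC) (asboolW hD) Ca Da.
Qed.

(** The deeper component is connected and avoids the smaller set [F (lvl t)], so meeting [cmp t]
    once forces containment. *)
Lemma below_of s t a : lvl t <= lvl s -> cmp s a -> cmp t a -> below t s.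
Proof.
move=> ts sa ta; split=> //.
apply: (component_max (cmpP t) (@cmp_conn s) _ ta sa) => b /cmp_F nb tb.
by apply: nb; apply: F_sub tb.
Qed.

Lemma below_refl t : below t t. Proof. by split. Qed.

Lemma below_trans t s p : below t s -> below s p -> below t p.
Proof.
move=> [ts st] [sp ps]; split; first exact: leq_trans sp.
exact: subset_trans st.
Qed.

Lemma child_below p s : child p s -> below p s.
Proof. by case=> e sp; split=> //; rewrite e. Qed.

Lemma child_nbelow p s : child p s -> ~ below s p.
Proof. by move=> [e _] []; rewrite e ltnn. Qed.

Lemma child_uniq p q s : child p s -> child q s -> p = q.
Proof.
move=> [ep sp] [eq sq]; have [a sa] := cmp_neq0 s.
by apply: (@node_eq _ _ a); [lia|exact: sp|exact: sq].
Qed.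

Lemma ancestor s n : n <= lvl s -> exists t, lvl t = n /\ below t s.
Proof.
move=> ns; have [a sa] := cmp_neq0 s.
have [|t [tn ta]] := @node_of n a; first by move=> /(F_sub ns); apply: cmp_F.
by exists t; split=> //; apply: below_of sa ta; rewrite tn.
Qed.

Lemma parent s : 0 < lvl s -> exists p, child p s.
Proof.
move=> s0; have [|p [pn [_ sp]]] := @ancestor s (lvl s).-1; first exact: leq_pred.
by exists p; split=> //; rewrite pn prednK.
Qed.

Lemma below_eq t s : below t s -> lvl s <= lvl t -> s = t.
Proof.
move=> [ts st] st'; have [a sa] := cmp_neq0 s.
by apply: (node_eq _ sa (st _ sa)); apply/eqP; rewrite eqn_leq st'.
Qed.

Lemma below_child t s : below t s -> s <> t -> exists2 p, child p s & below t p.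
Proof.
move=> ts st; have lt : lvl t < lvl s.
  by rewrite ltnNge; apply/negP => /(below_eq ts).
have [|p ps] := @parent s; first exact: leq_ltn_trans lt.
exists p => //; have [a sa] := cmp_neq0 s.
apply: (@below_of _ _ a); first by case: ps => e _; lia.
  exact: (proj2 ps).
exact: (proj2 ts).
Qed.

Lemma below_ind (P : node -> Prop) t : P t ->
  (forall p s, below t p -> child p s -> P p -> P s) ->
  forall s, below t s -> P s.
Proof.
move=> Pt step s; have [n] := ubnP (lvl s); elim: n s => // n IH s sn ts.
have [->//|st] := pselect (s = t).
have [p ps tp] := below_child ts st.
by apply: (step p) => //; apply: IH => //; case: ps => e _; lia.
Qed.

(** * The tree and the two sides of its edges *)

Definition tree_adj : rel node := [rel s t | `[< child s t \/ child t s >]].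

Lemma tree_adjP s t : reflect (child s t \/ child t s) (tree_adj s t).
Proof. exact: asboolP. Qed.

Lemma tree_adj_sym : symmetric tree_adj.
Proof. by move=> s t; apply/tree_adjP/tree_adjP => -[]; by [right|left]. Qed.

Lemma tree_adj_irrefl : irreflexive tree_adj.
Proof. by move=> s; apply/negP => /tree_adjP[][e _]; move: e; lia. Qed.

Definition tree : graph := Graph tree_adj_sym tree_adj_irrefl.

(** Children never leave the subtree at t, and by uniqueness of parents a node of it other than t
    has its parent there. *)
Lemma adj_below t s s' : tree_adj s s' -> below t s -> ~ below t s' ->
  s = t /\ child s' t.
Proof.
move=> /tree_adjP[/child_below h|h] ts nts'.
  by case: nts'; apply: below_trans h.
have [st|nst] := pselect (s = t); first by rewrite -st.
have [p ps tp] := below_child ts nst.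
by case: nts'; rewrite (child_uniq h ps).
Qed.

Lemma below_joined t s : below t s -> @joined tree (below t) t s.
Proof.
move: s; apply: below_ind => [|p s tp ps IH].
  by apply: joined_refl; apply: below_refl.
apply: (joined_trans IH); apply: joined_edge => //.
  exact: below_trans (child_below ps).
by apply/tree_adjP; left.
Qed.

Lemma root_below t s : lvl t = 0 -> below t s.
Proof.
move=> t0; split; first by rewrite t0.
have [a ta] := cmp_neq0 t.
move=> b _; apply: (component_joined (cmpP t) ta).
by rewrite t0 F0 setC0; apply: (proj2 hG).
Qed.

Lemma ex_root : exists t, lvl t = 0.
Proof.
have [[a] _] := hG; have [|t [t0 _]] := @node_of 0 a; first by rewrite F0.
by exists t.
Qed.

Lemma ex_max_lvl s (c : seq node) :
  exists2 t, t \in s :: c & forall r, r \in s :: c -> lvl r <= lvl t.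
Proof.
elim: c s => [|a c IH] s.
  by exists s; rewrite ?inE // => r; rewrite inE => /eqP->.
have [t tc tmax] := IH a; have [st|ts] := leqP (lvl s) (lvl t).
  exists t; first by rewrite inE tc orbT.
  by move=> r; rewrite inE => /predU1P[->|/tmax].
exists s; rewrite ?mem_head // => r; rewrite inE => /predU1P[->//|/tmax rt].
exact: ltnW (leq_ltn_trans rt ts).
Qed.

(** Nodes are connected through the root. On a cycle, both neighbours of a vertex of maximal level
    would be its parent, but parents are unique. *)
Lemma tree_is_tree : is_tree tree.
Proof.
split.
  have [t t0] := ex_root; split; first by exists.
  move=> r s; apply: joined_sub (@subsetT _ _) _.
  apply: (joined_trans _ (below_joined (root_below s t0))).
  exact: joined_sym (below_joined (root_below r t0)).
case=> // s c sz; apply/negP => /andP[cyc uc].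
have [t tc tmax] := ex_max_lvl s c.
have [i c' ec] := rot_to tc.
have szc : size (t :: c') = size (s :: c) by rewrite -ec size_rot.
move: uc cyc; rewrite -(rot_uniq i) -(rot_cycle i) ec.
have cmax r : r \in c' -> lvl r <= lvl t.
  by move=> rc; apply: tmax; rewrite -(mem_rot i) ec inE rc orbT.
case: c' szc cmax {ec} => [|a c'] /=; first by case: (c) sz.
case/lastP: c' => [|c' b]; first by case: (c) sz => // ? [].
move=> _ cmax /and3P[_ ac _] /andP[ta]; rewrite rcons_path => /andP[_].
rewrite last_rcons => bt.
have up r : r \in a :: rcons c' b -> tree_adj t r -> child r t.
  by move=> rc /tree_adjP[[e _]|//]; have := cmax r rc; lia.
have at' : child a t by apply: up; rewrite ?mem_head.
have bt' : child b t.
  by apply: up; [rewrite inE mem_rcons mem_head orbT|rewrite tree_adj_sym].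
by move: ac; rewrite (child_uniq at' bt') mem_rcons mem_head.
Qed.

Lemma side_child x y s : child y x -> @side tree x y s <-> below x s.
Proof.
move=> yx; split.
  apply: joined_ind; first exact: below_refl.
  move=> a b xa _ /and3P[ab nab _]; apply: contrapT => nxb.
  have [ax bx] := adj_below ab xa nxb.
  by move: nab; rewrite ax (child_uniq bx yx) eqxx.
move: s; apply: below_ind => [|p s xp ps IH]; first exact: joined_refl.
apply: (joined_trans IH); apply: joined_edge => //; apply/and3P; split.
- by apply/tree_adjP; left.
- apply/negP => /eqP[ep es]; move: ps yx; rewrite ep es => -[e _] [e' _]; lia.
- by apply/negP => /eqP[ep es]; apply: (child_nbelow yx); rewrite -ep.
Qed.

(** Every node outside the subtree at x reaches the root through its ancestors, none of which lies
    below x, so the deleted edge is avoided. *)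
Lemma side_parent x y s : child y x -> @side tree y x s <-> ~ below x s.
Proof.
move=> yx; split.
  apply: (@joined_ind (del_edge (y : tree) x) setT (~` below x)).
    exact: child_nbelow.
  move=> a b nxa _ /and3P[ab nab _] xb.
  have ba : tree_adj b a by rewrite tree_adj_sym.
  have [bx ax] := adj_below ba xb nxa.
  by move: nab; rewrite bx (child_uniq ax yx) eqxx.
have [t t0] := ex_root.
suff J r : below t r -> ~ below x r -> @joined (del_edge (y : tree) x) setT t r.
  move=> nxs; apply: joined_trans (J s (root_below s t0) nxs).
  by apply/joined_sym/J; [exact: root_below|exact: child_nbelow].
move: r; apply: below_ind => [_|p r tp pr IH nxr]; first exact: joined_refl.
have nxp : ~ below x p by move=> xp; apply: nxr; apply: below_trans (child_below pr).
apply: (joined_trans (IH nxp)); apply: joined_edge => //; apply/and3P; split.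
- by apply/tree_adjP; left.
- by apply/negP => /eqP[_ rx]; apply: nxr; rewrite rx; apply: below_refl.
- by apply/negP => /eqP[px _]; apply: nxp; rewrite px; apply: below_refl.
Qed.

(** * The parts and the axioms of a tree-decomposition *)

Definition tpart (t : tree) : set G := F (lvl t).+1 `&` cl t.

Lemma below_cl t s : below t s -> cl s `<=` cl t.
Proof.
move=> [_ st] v [/st|[nv [c /st tc cv]]]; first by left.
by have [tv|ntv] := pselect (cmp t v); [left|right; split=> //; exists c].
Qed.

Lemma nbhd_tpart t : nbhd (cmp t) `<=` tpart t.
Proof. by move=> v nv; split; [apply/Finc/nbhd_F|right]. Qed.

(** As [F 0] is empty, v enters at some [F n.+1] without lying in [F n]; its component at level n is
    the required node. *)
Lemma home v : exists t, tpart t v /\ cmp t v.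
Proof.
have [[|n] [Fn nmin]] := ex_least (Fcov v); first by rewrite F0 in Fn.
have [|t [tn tv]] := @node_of n v; first by move=> /nmin; rewrite ltnn.
by exists t; split=> //; split; [rewrite tn|left].
Qed.

(** As v is not in [F (lvl x)], a part containing v has level at least [lvl x]; then v itself, or a
    neighbour of v in [cmp s], lies in both components. *)
Lemma cmp_tpart_below x s v : cmp x v -> tpart s v -> below x s.
Proof.
move=> xv [Fv sv]; have nF := cmp_F xv.
have xs : lvl x <= lvl s.
  by rewrite leqNgt; apply/negP => sx; apply: nF; apply: F_sub Fv.
case: sv => [sv|[_ [c sc cv]]]; first exact: below_of sv xv.
apply: (below_of xs sc); apply: (component_closed (cmpP x) xv).
  by move=> Fc; apply: (cmp_F sc); apply: F_sub Fc.
by rewrite adj_sym.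
Qed.

Lemma tpart_sep x s s' v : below x s -> ~ below x s' -> tpart s v -> tpart s' v ->
  nbhd (cmp x) v.
Proof.
move=> xs nxs' [_ /(below_cl xs)[xv|//]] s'v.
by case: nxs'; apply: cmp_tpart_below s'v.
Qed.

(** The neighbourhood of a component at level n+1 lies in [F n.+1], hence in the part of the parent
    at level n. Adhesion sets are therefore finite by [finite_nbhd]. *)
Lemma adhesion_child x y : child y x -> tpart x `&` tpart y = nbhd (cmp x).
Proof.
move=> yx; rewrite eqEsubset; split=> v.
  by case=> xv yv; apply: tpart_sep (child_nbelow yx) xv yv; apply: below_refl.
move=> xv; split; first exact: nbhd_tpart.
split; first by rewrite -(proj1 yx); apply: nbhd_F.
by apply: (below_cl (child_below yx)); right.
Qed.

Lemma path_below b a (q : seq tree) : path adj a q -> below b a ->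
  (forall z, z \in q -> ~ child z b) -> below b (last a q).
Proof.
elim: q a => //= c q IH a /andP[ac cq] ba nq; apply: (IH c cq) => [|z zq].
  apply: contrapT => nbc; have [_] := adj_below ac ba nbc.
  by apply: nq; rewrite mem_head.
by apply: nq; rewrite inE zq orbT.
Qed.

Lemma path_nbelow b a (q : seq tree) : path adj a q -> ~ below b a -> b \notin q ->
  ~ below b (last a q).
Proof.
elim: q a => //= c q IH a /andP[ac cq] nba.
rewrite inE negb_or => /andP[bc bq]; apply: (IH c cq) => // hbc.
have ca : tree_adj c a by rewrite tree_adj_sym.
have [cb _] := adj_below ca hbc nba.
by rewrite cb eqxx in bc.
Qed.

(** Induction on the path: as it does not return to t1, its first edge separates t1 from t3, so v
    lies in the adhesion set of that edge and hence in the next part. *)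
Lemma tpart_path (t1 t2 t3 : tree) (q : seq tree) : is_path t1 t3 q ->
  t2 \in t1 :: q -> tpart t1 `&` tpart t3 `<=` tpart t2.
Proof.
move=> P m v; elim: q t1 P m => [|a q IH] t1 [].
  by move=> _ _ <-; rewrite inE => /eqP-> [].
move=> /= /andP[t1a aq] /and3P[t1q auq uq] la m [v1 v3].
have t1nq : t1 \notin q by move: t1q; rewrite inE negb_or => /andP[].
move: m; rewrite inE => /predU1P[->//|m].
suff va : tpart a v by apply: (IH a) => //; split=> //=; rewrite auq.
case/tree_adjP: t1a => h.
  apply: nbhd_tpart; apply: (@tpart_sep a t3 t1) => //; last exact: child_nbelow.
  rewrite -la; apply: path_below (below_refl _) _ => // z zq za.
  by move: t1nq; rewrite (child_uniq h za) zq.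
have : nbhd (cmp t1) v.
  apply: (@tpart_sep t1 t1 t3) => //; first exact: below_refl.
  by rewrite -la; apply: path_nbelow aq (child_nbelow h) t1nq.
by rewrite -(adhesion_child h) => -[].
Qed.

Lemma tpart_vertex v : exists t, tpart t v.
Proof. by have [t [tv _]] := home v; exists t. Qed.

(** Of the homes of u and v, the one of larger level works: the other endpoint has already entered
    [F] there and is in the component or adjacent to it. *)
Lemma tpart_edge u v : adj u v -> exists t, tpart t u /\ tpart t v.
Proof.
wlog : u v / exists s t,
    [/\ tpart s u, cmp s u, tpart t v, cmp t v & lvl s <= lvl t].
  move=> wl uv; have [s [su su']] := home u; have [t [tv tv']] := home v.
  have [st|/ltnW ts] := leqP (lvl s) (lvl t); first by apply: wl => //; exists s, t.
  have [||r [rv ru]] := wl v u; last by exists r.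
    by exists t, s.
  by rewrite adj_sym.
move=> [s [t [[Fu _] su tv tv' st]]] uv; exists t; split=> //.
split; first by apply: F_sub Fu; rewrite ltnS.
have [tu|ntu] := pselect (cmp t u); [by left|right; split=> //].
by exists v => //; rewrite adj_sym.
Qed.

Definition component_decomposition : tree_decomposition G :=
  TreeDecomposition tree_is_tree tpart_vertex tpart_edge tpart_path.

Local Notation D := component_decomposition.

(** * Orientations of tree edges by ends, and rays of the tree *)

Lemma lives_meet w s t : lives w (cmp s) -> lives w (cmp t) ->
  exists2 a, cmp s a & cmp t a.
Proof.
move=> ls lt; have [R Rw] := end_ray w.
have ts := lives_all (finite_nbhd s) (cmp_component s) ls Rw.
have tt := lives_all (finite_nbhd t) (cmp_component t) lt Rw.
by have [n [sn tn]] := tail_meet ts tt; exists (R n).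
Qed.

Lemma lives_below w s t : lives w (cmp s) -> lives w (cmp t) ->
  lvl t <= lvl s -> below t s.
Proof.
by move=> ls lt ts; have [a sa ta] := lives_meet ls lt; apply: below_of ts sa ta.
Qed.

Lemma lives_up w s t : below t s -> lives w (cmp s) -> lives w (cmp t).
Proof. by move=> [_ st] [R Rw tR]; exists R => //; apply: tail_sub tR. Qed.

Lemma lives_root w t : lvl t = 0 -> lives w (cmp t).
Proof.
move=> t0; have [S Sw] := end_ray w; exists S => //; exists 0 => k _.
have [a ta] := cmp_neq0 t; apply: (component_joined (cmpP t) ta).
by rewrite t0 F0 setC0; apply: (proj2 hG).
Qed.

(** The parts below x cover [cmp x] and lie in [cl x], so removing the adhesion set from the side of
    x leaves exactly [cmp x]. *)
Lemma orients_child w x y : child y x ->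
  @orients_towards G D w x y <-> lives w (cmp x).
Proof.
move=> yx; rewrite /orients_towards /adhesion_set /= adhesion_child //.
have fN := finite_nbhd x; have CN := cmp_component x; split=> [OC|lx].
  have [CC lC] := end_componentP w fN.
  have [a Ca] := component_neq0 OC.
  have [[s xs sa] na] := component_sub OC Ca.
  suff xa : cmp x a by rewrite (component_eq CN CC xa Ca).
  have [//|/na//] : cl x a.
  by apply: (below_cl (proj1 (side_child s yx) xs)); case: sa.
rewrite (end_componentE fN CN lx); apply: (component_subset CN) => [v xv|v []//].
split; last by apply: component_sub CN _ xv.
have [t [tv tv']] := home v; exists t => //.
by apply/(side_child t yx)/(cmp_tpart_below xv tv).
Qed.

(** The end lives in another component of G - N(C), where C is [cmp x]; the homes of its vertices
    are not below x, as they would place these vertices in C. *)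
Lemma orients_parent w x y : child y x -> ~ lives w (cmp x) ->
  @orients_towards G D w y x.
Proof.
move=> yx nlx; rewrite /orients_towards /adhesion_set /= setIC adhesion_child //.
have fN := finite_nbhd x; have CN := cmp_component x.
have [CC lC] := end_componentP w fN.
apply: (component_subset CC) => [v Cv|v []//].
split; last by apply: component_sub CC _ Cv.
have [t [tv tv']] := home v; exists t => //.
apply/(side_parent t yx) => xt; apply: nlx.
by rewrite (component_eq CN CC (proj2 xt _ tv') Cv).
Qed.

(** Levels cannot drop forever, so the ray goes down at some step. Going up after a downward step
    would revisit the unique parent. *)
Lemma ray_descends (R : ray tree) :
  exists m, forall k, child (R (k + m)) (R (k + m).+1).
Proof.
have adjR n : child (R n) (R n.+1) \/ child (R n.+1) (R n).
  exact/tree_adjP/(ray_adj R n).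
have [m Rm] : exists m, child (R m) (R m.+1).
  apply: contrapT => no.
  have down n : lvl (R n) + n = lvl (R 0).
    elim: n => [|n <-]; first by rewrite addn0.
    by case: (adjR n) => [h|[-> _]]; [case: no; exists n|lia].
  by have := down (lvl (R 0)).+1; lia.
exists m; elim=> [//|k IH]; rewrite addSn; case: (adjR (k + m).+1) => // h.
by have := @ray_inj tree R _ _ (child_uniq h IH); lia.
Qed.

Lemma descends_lvl (r : nat -> node) : (forall k, child (r k) (r k.+1)) ->
  forall k, lvl (r k) = k + lvl (r 0).
Proof. by move=> h; elim=> // k IH; rewrite (proj1 (h k)) IH. Qed.

Lemma descends_below (r : nat -> node) : (forall k, child (r k) (r k.+1)) ->
  forall k l, k <= l -> below (r k) (r l).
Proof.
move=> h k l /subnK<-; elim: (l - k) => [|d IH]; first exact: below_refl.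
by apply: below_trans IH _; apply: child_below; apply: h.
Qed.

Lemma descends_tail (R : ray tree) m n :
  (forall k, child (R (k + m)) (R (k + m).+1)) ->
  n <= lvl (R (n + m)) /\ tail_in R (below (R (n + m))).
Proof.
move=> h; pose r k := R (k + m).
have hr k : child (r k) (r k.+1) by apply: h.
split; first by rewrite (descends_lvl hr) leq_addr.
exists (n + m) => k nk; have -> : R k = r (k - m) by rewrite /r subnK //; lia.
by apply: (descends_below hr); lia.
Qed.

Lemma tail_deep (R : ray tree) n : exists t, n <= lvl t /\ tail_in R (below t).
Proof.
by have [m h] := ray_descends R; exists (R (n + m)); apply: descends_tail.
Qed.

(** The subtree at t is a component of the tree minus the parent of t, so [equiv_tail] applies. *)
Lemma end_below (R R' : ray tree) t : ray_equiv R R' -> tail_in R (below t) ->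
  tail_in R' (below t).
Proof.
move=> RR'; have [t0|t0] := posnP (lvl t).
  by move=> _; exists 0 => k _; apply: root_below.
have [p pt] := parent t0; apply: (@equiv_tail tree [set p]) => //.
apply: (@componentI tree _ _ t) => [|a b ta tb|a ta ap|a b ta /= nbp ab].
- exact: below_refl.
- exact: joined_trans (joined_sym (below_joined ta)) (below_joined tb).
- by apply: (child_nbelow pt); rewrite -ap.
apply: contrapT => ntb; apply: nbp.
by have [_ bt] := adj_below ab ta ntb; apply: child_uniq bt pt.
Qed.

(** * The end map and the displayed ends *)

Definition lives_through w : Prop :=
  forall n, exists C, component (~` F n) C /\ lives w C.

Lemma lives_throughP w : lives_through w <->
  forall n, exists t, n <= lvl t /\ lives w (cmp t).
Proof.
split=> h n; last first.
  have [s [ns ls]] := h n; have [t [tn ts]] := ancestor ns.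
  exists (cmp t); split; last exact: lives_up ts ls.
  by rewrite -tn; apply: cmpP.
have [C [CC lC]] := h n; exists (exist _ (n, C) (asboolT CC)); split=> //.
Qed.

Lemma points_end w (h : graph_end tree) (R : ray tree) t :
  @points_towards G D w (inr h) -> in_end R h -> tail_in R (below t) ->
  lives w (cmp t).
Proof.
move=> wh Rh tR; have [t0|t0] := posnP (lvl t).
  exact: lives_root.
have [p pt] := parent t0; apply/(orients_child w pt)/wh.
  by apply/tree_adjP; right.
move=> R' R'h; have := end_below (in_end_equiv Rh R'h) tR.
by apply: tail_sub => s ts; apply/side_child.
Qed.

(** If w lives at every level, the nodes in which it lives form a descending ray. Otherwise w lives
    in some node t but in no child of t, and t is its image. *)
Lemma ex_points w : exists z, @points_towards G D w z /\
  ((exists h, z = inr h) <-> lives_through w).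
Proof.
have [/lives_throughP h|nthr] := pselect (lives_through w).
  have /choice[r rP] n : exists t, lvl t = n /\ lives w (cmp t).
    have [s [ns ls]] := h n; have [t [tn ts]] := ancestor ns.
    by exists t; split=> //; apply: lives_up ts ls.
  have rc n : child (r n) (r n.+1).
    have [rn ln] := rP n; have [rn1 ln1] := rP n.+1.
    split; first by rewrite rn rn1.
    by apply: (proj2 (lives_below ln1 ln _)); rewrite rn rn1.
  have rinj : injective r.
    by move=> m n /(congr1 lvl); rewrite (proj1 (rP m)) (proj1 (rP n)).
  have radj n : @adj tree (r n) (r n.+1) by apply/tree_adjP; left.
  exists (inr (end_of (@Ray tree r rinj radj))); split; last first.
    by split=> _; [apply/lives_throughP|eexists].
  move=> x y /tree_adjP xy /(_ _ (@in_end_of _ _))[m tm].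
  (* Past m the ray stays on the given side, and [r l] is at least as deep as x and y, as
     [lives_below] requires. *)
  have [l ml xl] : exists2 l, m <= l & lvl x <= l /\ lvl y <= l.
    by exists (m + (lvl x + lvl y)); lia.
  case: xy => [xy|yx].
    apply: orients_parent => // ly.
    apply: (proj1 (side_parent (r l) xy) (tm l ml)).
    by apply: lives_below (proj2 (rP l)) ly _; rewrite (proj1 (rP l)); case: xl.
  apply/orients_child => //; apply: lives_up (proj2 (rP l)).
  exact: (proj1 (side_child (r l) yx) (tm l ml)).
have [t [lt nch]] : exists t,
    lives w (cmp t) /\ forall s, child t s -> ~ lives w (cmp s).
  apply: contrapT => no; apply/nthr/lives_throughP.
  elim=> [|n [t [nt lt]]].
    have [t t0] := ex_root; exists t; split=> //.
    exact: lives_root.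
  apply: contrapT => no'; apply: no; exists t; split=> // s [e ts] ls.
  by apply: no'; exists s; split=> //; rewrite e ltnS.
exists (inl t); split; last by split=> [[]//|].
move=> x y /tree_adjP[xy|yx] st; last first.
  by apply/orients_child => //; apply: lives_up lt; exact: (proj1 (side_child t yx) st).
apply: orients_parent => // ly.
have nyt := proj1 (side_parent t xy) st.
have ty : lvl t < lvl y.
  rewrite ltnNge; apply/negP => yt; apply: nyt; exact: lives_below lt ly yt.
have [s [es sy]] := ancestor ty; have ls := lives_up sy ly.
apply: (nch s) => //; split=> //.
by apply: (proj2 (lives_below ls lt _)); rewrite es.
Qed.

Lemma component_decomposition_adhesion : finite_adhesion D.
Proof.
move=> x y /tree_adjP[xy|yx].
  by rewrite /adhesion_set /= setIC adhesion_child //; apply: finite_nbhd.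
by rewrite /adhesion_set /= adhesion_child //; apply: finite_nbhd.
Qed.

Lemma component_decomposition_displays : displays D [set w | lives_through w].
Proof.
have [f fP] := choice ex_points; exists f.
have eF : [set w | lives_through w] = f @^-1` range inr.
  rewrite eqEsubset; split=> w /=; case: (fP w) => _ [h1 h2].
    by move=> /h2[h ->]; exists h.
  by move=> [h _ e]; apply: h1; exists h.
have deep w h n : f w = inr h -> exists t,
    [/\ n <= lvl t, lives w (cmp t) & forall R, in_end R h -> tail_in R (below t)].
  move=> e; have [R Rh] := end_ray h; have [t [nt tR]] := tail_deep R n.
  exists t; split=> //.
    by apply: points_end Rh tR; rewrite -e; case: (fP w).
  by move=> R' R'h; apply: end_below tR; apply: in_end_equiv Rh R'h.
split=> //; first by move=> w; case: (fP w).
split.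
- by rewrite eF => w.
(* Ends with the same image h live together in arbitrarily deep components, which are connected and
   eventually avoid any finite X. *)
- move=> w1 w2 /set_mem; rewrite eF => -[h _ e1] _ e2; rewrite -e1 in e2.
  have [R1 R1w] := end_ray w1; have [R2 R2w] := end_ray w2.
  apply: (end_eq R1w R2w); apply: equivI => X /(exhaustion_avoid Finc Fcov)[n Xn].
  have [R Rh] := end_ray h; have [t [nt tR]] := tail_deep R n.
  have l1 : lives w1 (cmp t).
    by apply: points_end Rh tR; rewrite e1; case: (fP w1).
  have l2 : lives w2 (cmp t).
    by apply: points_end Rh tR; rewrite e2; case: (fP w2).
  exists (cmp t); split.
  + exact: cmp_conn.
  + by move=> a /cmp_F na /Xn Fa; apply: na; apply: F_sub Fa.
  + exact: lives_all (finite_nbhd t) (cmp_component t) l1 R1w.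
  + exact: lives_all (finite_nbhd t) (cmp_component t) l2 R2w.
(* Surjectivity: the components along a ray of h decrease to the empty set, so [nested_ray] finds a
   ray of G whose end lives in all of them. It remains to compare its image h' with h. *)
move=> _ [h _ <-]; have [R Rh] := end_ray h.
have [m Rm] := ray_descends R; pose r k := R (k + m).
have hr k : child (r k) (r k.+1) by apply: Rm.
have [|||S [_ St]] := @nested_ray G (fun k => cmp (r k)) (fun k => proj2 (hr k)).
- move=> x; have [n Fx] := Fcov x; exists n => /cmp_F; apply.
  by apply: F_sub Fx; rewrite descends_lvl // leq_addr.
- by move=> k; apply: cmp_conn.
- by move=> k; apply: cmp_neq0.
pose w := end_of S.
have lr k : lives w (cmp (r k)) by exists S => //; apply: in_end_of.
have wl : lives_through w.
  by apply/lives_throughP => n; exists (r n); rewrite descends_lvl // leq_addr.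
exists w => //; have [h' e] := proj2 (proj2 (fP w)) wl; rewrite e; congr inr.
have [R' R'h'] := end_ray h'.
apply: (end_eq R'h' Rh); apply: equivI => X fX.
have [n nX] : exists n, [set s | n <= lvl s] `<=` ~` X.
  apply: (@nested_avoid tree (fun n => [set s | n <= lvl s])) => //.
    by move=> k s /ltnW.
  by move=> s; exists (lvl s).+1; rewrite /= ltnn.
have [t [nt lt tR']] := deep w h' n e.
have [nr tR] := descends_tail n Rm.
have deepX s : n <= lvl s -> below s `<=` ~` X.
  by move=> ns s' [ss' _]; apply: nX; apply: leq_trans ss'.
have below_conn s : @conn tree (below s).
  by move=> a b /below_joined sa /below_joined; apply: joined_trans (joined_sym sa).
(* As w lives in both deep nodes they are comparable; the subtree at the shallower one avoids X and
   contains tails of rays of both h and h'. *)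
have [tr|/ltnW rt] := leqP (lvl t) (lvl (r n)).
  exists (below t); split; [exact: below_conn|exact: deepX|exact: tR'|].
  apply: tail_sub tR => s; apply: below_trans.
  exact: lives_below (lr n) lt tr.
exists (below (r n)); split; [exact: below_conn|exact: deepX| |exact: tR].
apply: tail_sub (tR' _ R'h') => s; apply: below_trans.
exact: lives_below lt (lr n) rt.
Qed.

End Tree.

Unset Implicit Arguments.

Theorem theorem10p2 (G : graph) (U : set G)
    (hG : connected_graph G) (hU : infinite_set U) :
  exists D : tree_decomposition G,
    finite_adhesion D /\
    displays D [set w : graph_end G | end_boundary U w /\ ~ dominated w].
Proof.
have [F [F0 Finc Fcov Fadh Fbd]] := boundary_exhaustion hG (infinite_setN0 hU).
exists (component_decomposition hG F0 Finc Fcov); split.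
  exact: component_decomposition_adhesion.
rewrite (_ : [set w | _] = [set w | lives_through F w]).
  exact: component_decomposition_displays.
by rewrite eqEsubset; split=> w /Fbd.
Qed.
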